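(* Let $C$ be a contractible globular extension with a pregroupoidal structure and let $f\colon G\to H$ be a morphism of $\infty$-groupoids of type $C$. The following are equivalent: (1) $f$ is a weak equivalence; (2) $\pi_0(f)\colon\pi_0(G)\to\pi_0(H)$ is a bijection and for every $n\ge1$ and every $(n-1)$-arrow $u$ of $G$, $f$ induces a group isomorphism $\pi_n(G,u)\to\pi_n(H,f(u))$; (3) the functor $\Pi_1(f)\colon\Pi_1(G)\to\Pi_1(H)$ is an equivalence of categories and for every $n\ge2$ and every pair $u,v$ of parallel $(n-1)$-arrows of $G$, $f$ induces a bijection $\pi_n(G,u,v)\to\pi_n(H,f(u),f(v))$; (4) the functor $\Pi_1(f)$ is full and essentially surjective and for every $n\ge2$ and every pair $u,v$ of parallel $(n-1)$-arrows of $G$, $f$ induces a surjection $\pi_n(G,u,v)\to\pi_n(H,f(u),f(v))$.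
   Context: The globe category $\mathbb{G}$ has objects $D_n$ ($n\ge0$), generated by $\sigma_n,\tau_n\colon D_{n-1}\to D_n$ ($n\ge1$) with $\sigma_{n+1}\sigma_n=\tau_{n+1}\sigma_n$, $\sigma_{n+1}\tau_n=\tau_{n+1}\tau_n$; $\sigma^i_j=\sigma_i\cdots\sigma_{j+1}$, $\tau^i_j=\tau_i\cdots\tau_{j+1}$. A table of dimensions: integers $i_1,\dots,i_n,i'_1,\dots,i'_{n-1}$ with $i_k>i'_k<i_{k+1}$; dimension = largest entry. In a category $C$ under $\mathbb{G}$, its globular sum is the colimit of $D_{i_1}\xleftarrow{\sigma^{i_1}_{i'_1}}D_{i'_1}\xrightarrow{\tau^{i_2}_{i'_1}}D_{i_2}\leftarrow\cdots\xrightarrow{\tau^{i_n}_{i'_{n-1}}}D_{i_n}$, written $D_{i_1}\amalg_{D_{i'_1}}\cdots\amalg_{D_{i'_{n-1}}}D_{i_n}$. A globular extension is a category under $\mathbb{G}$ with all globular sums. $f,g\colon D_n\to X$ are globularly parallel if $n=0$ or $f\sigma_n=g\sigma_n$, $f\tau_n=g\tau_n$; a lifting of $(f,g)$ is $h\colon D_{n+1}\to X$ with $h\sigma_{n+1}=f$, $h\tau_{n+1}=g$; $(f,g)\colon D_n\to S$ is admissible if globularly parallel with $S$ a globular sum of dimension $\le n+1$; $C$ is contractible if every admissible pair has a lifting. An $\infty$-groupoid of type $C$ is a presheaf $G$ on $C$ such that each canonical map $G(D_{i_1}\amalg_{D_{i'_1}}\cdots\amalg_{D_{i'_{n-1}}}D_{i_n})\to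 G_{i_1}\times_{G_{i'_1}}\cdots\times_{G_{i'_{n-1}}}G_{i_n}$ is bijective, where $G_i=G(D_i)$ ($i$-arrows), $s=G(\sigma_i)$, $t=G(\tau_i)$ (source, target), $s^i_j=G(\sigma^i_j)$, $t^i_j=G(\tau^i_j)$, and the fiber product consists of $(u_1,\dots,u_n)$ with $s^{i_k}_{i'_k}(u_k)=t^{i_{k+1}}_{i'_k}(u_{k+1})$. Morphisms are natural transformations. Two $i$-arrows are parallel if $i=0$ or they have the same source and target. A pregroupoidal structure on $C$ consists of morphisms $\nabla^i_j\colon D_i\to D_i\amalg_{D_j}D_i$ ($i>j\ge0$), $\kappa_i\colon D_{i+1}\to D_i$, $w^i_j\colon D_i\to D_i$ with $\nabla^i_{i-1}\sigma_i=\epsilon_2\sigma_i$, $\nabla^i_{i-1}\tau_i=\epsilon_1\tau_i$ ($\epsilon_1,\epsilon_2$ the canonical inclusions of the first and second summand), $\nabla^i_j\sigma_i=(\sigma_i\amalg_{D_j}\sigma_i)\nabla^{i-1}_j$, $\nabla^i_j\tau_i=(\tau_i\amalg_{D_j}\tau_i)\nabla^{i-1}_j$ for $j<i-1$, $\kappa_i\sigma_{i+1}=\kappa_i\tau_{i+1}=\mathrm{id}$, $w^i_{i-1}\sigma_i=\tau_i$, $w^i_{i-1}\tau_i=\sigma_i$, $w^i_j\sigma_i=\sigma_iw^{i-1}_j$, $w^i_j\tau_i=\tau_iw^{i-1}_j$ for $j<i-1$. It induces on $G$: compositions $v\ast^i_ju=G(\nabla^i_j)(\xi)$ for $s^i_j(v)=t^i_j(u)$,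 $\xi$ corresponding to $(v,u)$; units $k_i=G(\kappa_i)\colon G_i\to G_{i+1}$, $k^i_j=k_{i-1}\cdots k_j\colon G_j\to G_i$. For $n$-arrows $u,v$, $u\sim v$ if some $(n+1)$-arrow has source $u$ and target $v$. $\pi_0(G)=G_0/\sim$. $\Pi_1(G)$ is the groupoid with objects $G_0$, arrows $G_1/\sim$, composition induced by $\ast^1_0$ and identities by $k_0$. For parallel $(n-1)$-arrows $u,v$, $\pi_n(G,u,v)$ is the set of $n$-arrows from $u$ to $v$ modulo $\sim$; $\pi_n(G,u)=\pi_n(G,u,u)$ is a group via $\ast^n_{n-1}$; for an object $x$, $\pi_n(G,x)=\pi_n(G,k^{n-1}_0(x))$. A morphism $f\colon G\to H$ is a weak equivalence if $\pi_0(f)$ is a bijection and, for all $n\ge1$ and all objects $x$ of $G$, the induced morphism $\pi_n(G,x)\to\pi_n(H,f(x))$ is an isomorphism. *)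

(* Defs.v *)
From Stdlib Require Import Relations.Relation_Operators.
From mathcomp Require Import all_boot.

Set Implicit Arguments.
Unset Strict Implicit.
Unset Printing Implicit Defensive.

Record Cat := MkCat {
  Ob :> Type;
  Hom : Ob -> Ob -> Type;
  idm : forall a, Hom a a;
  comp : forall a b c, Hom b c -> Hom a b -> Hom a c;
  comp_id_l : forall a b (f : Hom a b), comp (idm b) f = f;
  comp_id_r : forall a b (f : Hom a b), comp f (idm a) = f;
  comp_assoc : forall a b c d (f : Hom a b) (g : Hom b c) (h : Hom c d),
      comp h (comp g f) = comp (comp h g) f }.
Arguments Hom {C} : rename.
Arguments idm {C} a : rename.
Arguments comp {C a b c} : rename.

(* Categories under the globe category G.                              *)
(* The non-identity morphisms D_j -> D_i of G (j < i) are exactly       *)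
(* sigma^i_j and tau^i_j, and the composite of any x^j_k (k<j) with any *)
(* y^i_j is x^i_k (this is what the globular relations say).  A functor *)
(* G -> C is therefore the data  gl j i true = image of sigma^i_j,      *)
(* gl j i false = image of tau^i_j, subject to functoriality.          *)
Record GlobCat := MkGlobCat {
  gcat :> Cat;
  D : nat -> gcat;
  gl : forall (j i : nat), bool -> j < i -> Hom (D j) (D i);
  gl_comp : forall k j i (b b' : bool) (h1 : k < j) (h2 : j < i) (h3 : k < i),
      comp (gl b' h2) (gl b h1) = gl b h3 }.
Arguments D {g} n : rename.
Arguments gl {g j i} b h : rename.

(* sigma_{m+1}, tau_{m+1} : D_m -> D_{m+1} *)
Definition sig (C : GlobCat) (m : nat) : Hom (@D C m) (@D C m.+1) := gl true (ltnSn m).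
Definition tau (C : GlobCat) (m : nat) : Hom (@D C m) (@D C m.+1) := gl false (ltnSn m).
Arguments sig {C} m.
Arguments tau {C} m.

(* Tables of dimensions:  i_1..i_{n} (tdim, indexed by 'I_(tn+1)) and   *)
(* i'_1..i'_{n-1} (tlow, indexed by 'I_tn), with i_k > i'_k < i_{k+1}.  *)
Record table := Table {
  tn : nat;
  tdim : 'I_tn.+1 -> nat;
  tlow : 'I_tn -> nat;
  tcond_l : forall k : 'I_tn, tlow k < tdim (widen_ord (leqnSn tn) k);
  tcond_r : forall k : 'I_tn, tlow k < tdim (lift ord0 k) }.
Arguments tdim T k : rename, clear implicits.
Arguments tlow T k : rename, clear implicits.
Arguments tcond_l T k : rename, clear implicits.
Arguments tcond_r T k : rename, clear implicits.

(* dimension of a table = largest entry (the i_k dominate the i'_k) *)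
Definition tdimension (T : table) : nat := \max_(k < (tn T).+1) tdim T k.

Section Colim.
Variable C : GlobCat.

(* cocones on the diagram  D_{i_1} <- D_{i'_1} -> D_{i_2} <- ... -> D_{i_n} *)
Definition cocone (T : table) (X : C) (e : forall k, Hom (D (tdim T k)) X) : Prop :=
  forall k : 'I_(tn T),
    comp (e (widen_ord (leqnSn _) k)) (gl true (tcond_l T k))
    = comp (e (lift ord0 k)) (gl false (tcond_r T k)).

Definition is_colimit (T : table) (S : C) (e : forall k, Hom (D (tdim T k)) S) : Prop :=
  cocone e /\
  forall (X : C) (f : forall k, Hom (D (tdim T k)) X), cocone f ->
    exists h : Hom S X, (forall k, comp h (e k) = f k) /\
      forall h' : Hom S X, (forall k, comp h' (e k) = f k) -> h' = h.
End Colim.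

Record GlobExt := MkGlobExt {
  gbase :> GlobCat;
  gsum : table -> gbase;
  ginj : forall T k, Hom (D (tdim T k)) (gsum T);
  gsum_colim : forall T, @is_colimit gbase T (gsum T) (@ginj T) }.
Arguments gsum {g} T : rename.
Arguments ginj {g} T k : rename.

Section Contr.
Variable C : GlobExt.

Definition gparallel (n : nat) (X : C) : Hom (D n) X -> Hom (D n) X -> Prop :=
  match n return Hom (D n) X -> Hom (D n) X -> Prop with
  | 0 => fun _ _ => True
  | m.+1 => fun f g => comp f (sig m) = comp g (sig m) /\ comp f (tau m) = comp g (tau m)
  end.

Definition lifting (n : nat) (X : C) (f g : Hom (D n) X) (h : Hom (D n.+1) X) : Prop :=
  comp h (sig n) = f /\ comp h (tau n) = g.

Definition contractible : Prop :=
  forall (T : table) (n : nat) (f g : Hom (D n) (gsum T)),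
    tdimension T <= n.+1 -> gparallel f g -> exists h, lifting f g h.
End Contr.

Record Presheaf (C : Cat) := MkPresheaf {
  PO : C -> Type;
  PM : forall a b, Hom a b -> PO b -> PO a;
  PM_id : forall a x, PM (idm a) x = x;
  PM_comp : forall a b c (f : Hom a b) (g : Hom b c) x, PM (comp g f) x = PM f (PM g x) }.
Arguments PO {C} p a : rename.
Arguments PM {C} p {a b} f x : rename.

Record PMor (C : Cat) (G H : Presheaf C) := MkPMor {
  pm : forall a, PO G a -> PO H a;
  pm_nat : forall a b (f : Hom a b) x, pm (PM G f x) = PM H f (pm x) }.
Arguments pm {C G H} p {a} x : rename.

Definition is_infty_groupoid (C : GlobExt) (G : Presheaf C) : Prop :=
  forall T : table,
    (forall x y : PO G (gsum T),
        (forall k, PM G (ginj T k) x = PM G (ginj T k) y) -> x = y) /\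
    (forall u : forall k, PO G (D (tdim T k)),
        (forall k : 'I_(tn T),
            PM G (gl true (tcond_l T k)) (u (widen_ord (leqnSn _) k))
            = PM G (gl false (tcond_r T k)) (u (lift ord0 k))) ->
        exists x, forall k, PM G (ginj T k) x = u k).

Definition T2 (i j : nat) (h : j < i) : table :=
  @Table 1 (fun _ => i) (fun _ => j) (fun _ => h) (fun _ => h).

Definition eps1 : 'I_2 := ord0.
Definition eps2 : 'I_2 := ord_max.

Record pregroupoidal (C : GlobExt) := MkPregroupoidal {
  nabla : forall i j (h : j < i), Hom (@D C i) (@gsum C (T2 h));
  kappa : forall i, Hom (@D C i.+1) (@D C i);
  wrev : forall i j (h : j < i), Hom (@D C i) (@D C i);
  nabla_s1 : forall m (h : m < m.+1),
      comp (nabla h) (sig m) = comp (ginj (T2 h) eps2) (sig m);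
  nabla_t1 : forall m (h : m < m.+1),
      comp (nabla h) (tau m) = comp (ginj (T2 h) eps1) (tau m);
  (* i = m+1, j < i-1 = m ; u is sigma_i \amalg_{D_j} sigma_i, i.e. the unique
     map with u o eps_k = eps_k o sigma_i *)
  nabla_s : forall m j (h : j < m.+1) (h' : j < m)
      (u : Hom (@gsum C (T2 h')) (@gsum C (T2 h))),
      (forall k, comp u (ginj (T2 h') k) = comp (ginj (T2 h) k) (sig m)) ->
      comp (nabla h) (sig m) = comp u (nabla h');
  nabla_t : forall m j (h : j < m.+1) (h' : j < m)
      (u : Hom (@gsum C (T2 h')) (@gsum C (T2 h))),
      (forall k, comp u (ginj (T2 h') k) = comp (ginj (T2 h) k) (tau m)) ->
      comp (nabla h) (tau m) = comp u (nabla h');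
  kappa_s : forall i, comp (kappa i) (sig i) = idm (@D C i);
  kappa_t : forall i, comp (kappa i) (tau i) = idm (@D C i);
  wrev_s1 : forall m (h : m < m.+1), comp (wrev h) (sig m) = tau m;
  wrev_t1 : forall m (h : m < m.+1), comp (wrev h) (tau m) = sig m;
  wrev_s : forall m j (h : j < m.+1) (h' : j < m),
      comp (wrev h) (sig m) = comp (sig m) (wrev h');
  wrev_t : forall m j (h : j < m.+1) (h' : j < m),
      comp (wrev h) (tau m) = comp (tau m) (wrev h') }.
Arguments nabla {C} p {i j} h : rename.
Arguments kappa {C} p i : rename.

Section Ops.
Variables (C : GlobExt) (P : pregroupoidal C) (G : Presheaf C).

Definition cell (n : nat) : Type := PO G (D n).
Definition src (m : nat) : cell m.+1 -> cell m := PM G (sig m).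
Definition tgt (m : nat) : cell m.+1 -> cell m := PM G (tau m).

(* w = v *^i_j u  (defined when s^i_j v = t^i_j u): xi corresponds to (v,u) *)
Definition comp_rel (i j : nat) (h : j < i) (v u w : cell i) : Prop :=
  exists xi : PO G (gsum (T2 h)),
    PM G (ginj (T2 h) eps1) xi = v /\ PM G (ginj (T2 h) eps2) xi = u /\
    PM G (nabla P h) xi = w.

Definition kunit (i : nat) : cell i -> cell i.+1 := PM G (kappa P i).
Fixpoint kit (m : nat) : cell 0 -> cell m :=
  match m return cell 0 -> cell m with
  | 0 => fun x => x
  | p.+1 => fun x => kunit (kit p x)
  end.

(* u ~ v : some (n+1)-arrow from u to v ; simeq = the equivalence relation
   by which one quotients *)
Definition sim (n : nat) (u v : cell n) : Prop :=
  exists a : cell n.+1, src a = u /\ tgt a = v.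
Definition simeq (n : nat) : cell n -> cell n -> Prop :=
  clos_refl_sym_trans (cell n) (@sim n).

Definition parallel (m : nat) : cell m -> cell m -> Prop :=
  match m return cell m -> cell m -> Prop with
  | 0 => fun _ _ => True
  | p.+1 => fun u v => src u = src v /\ tgt u = tgt v
  end.
End Ops.
Arguments src {C G m} x.
Arguments tgt {C G m} x.
Arguments simeq {C} G n _ _.
Arguments comp_rel {C} P G {i j} h v u w.
Arguments kunit {C} P G {i} x.
Arguments kit {C} P G m x.
Arguments parallel {C} G m _ _.

Section Inv.
Variables (C : GlobExt) (P : pregroupoidal C) (G H : Presheaf C) (f : PMor G H).

Definition fc (n : nat) (x : cell G n) : cell H n := pm f x.

Definition pi0_bij : Prop :=
  (forall y : cell H 0, exists x : cell G 0, simeq H 0 (fc x) y) /\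
  (forall x x' : cell G 0, simeq H 0 (fc x) (fc x') -> simeq G 0 x x').

(* pi_{m+1}(G,u,v) -> pi_{m+1}(H,u',v') induced by f is surjective / injective *)
Definition pin_surj (m : nat) (u v : cell G m) (u' v' : cell H m) : Prop :=
  forall y : cell H m.+1, src y = u' -> tgt y = v' ->
    exists x : cell G m.+1, src x = u /\ tgt x = v /\ simeq H m.+1 (fc x) y.

Definition pin_inj (m : nat) (u v : cell G m) : Prop :=
  forall x x' : cell G m.+1, src x = u -> tgt x = v -> src x' = u -> tgt x' = v ->
    simeq H m.+1 (fc x) (fc x') -> simeq G m.+1 x x'.

Definition pin_bij (m : nat) (u v : cell G m) (u' v' : cell H m) : Prop :=
  pin_surj u v u' v' /\ pin_inj u v.

Definition pin_hom (m : nat) (u : cell G m) : Prop :=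
  forall x y w : cell G m.+1,
    src x = u -> tgt x = u -> src y = u -> tgt y = u ->
    comp_rel P G (ltnSn m) y x w ->
    forall w' : cell H m.+1, comp_rel P H (ltnSn m) (fc y) (fc x) w' ->
    simeq H m.+1 (fc w) w'.

Definition pin_group_iso (m : nat) (u : cell G m) (u' : cell H m) : Prop :=
  pin_bij u u u' u' /\ pin_hom u.

Definition Pi1_full : Prop :=
  forall x x' : cell G 0, pin_surj x x' (fc x) (fc x').
Definition Pi1_faithful : Prop :=
  forall x x' : cell G 0, pin_inj x x'.
Definition Pi1_esssurj : Prop :=
  forall y : cell H 0, exists x : cell G 0, exists a b : cell H 1,
    src a = fc x /\ tgt a = y /\ src b = y /\ tgt b = fc x /\
    (exists w, comp_rel P H (ltnSn 0) b a w /\ simeq H 1 w (kunit P H (fc x))) /\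
    (exists w, comp_rel P H (ltnSn 0) a b w /\ simeq H 1 w (kunit P H y)).
Definition Pi1_equiv : Prop := Pi1_full /\ Pi1_faithful /\ Pi1_esssurj.

Definition weak_equivalence : Prop :=
  pi0_bij /\
  forall (m : nat) (x : cell G 0), pin_group_iso (kit P G m x) (kit P H m (fc x)).

Definition cond2 : Prop :=
  pi0_bij /\ forall (m : nat) (u : cell G m), pin_group_iso u (fc u).

Definition cond3 : Prop :=
  Pi1_equiv /\
  forall (m : nat) (u v : cell G m), 0 < m -> parallel G m u v ->
    pin_bij u v (fc u) (fc v).

Definition cond4 : Prop :=
  Pi1_full /\ Pi1_esssurj /\
  forall (m : nat) (u v : cell G m), 0 < m -> parallel G m u v ->
    pin_surj u v (fc u) (fc v).
End Inv.

(* Main.v *)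
(* The heart is the implication from (1) to the rest.  Call an n-cell a good when f is
   bijective on the classes modulo ~ of the cells parallel to a.  The division lemma
   says that composing with a fixed n-cell over D_j is bijective on such classes, so it
   preserves and reflects goodness; it is proved by induction on n - j, comparing
   w(v) * (v * x) with x: both are values of families of operations
   D_m -> D_m +_{D_j} D_m commuting with sources and targets, and contractibility makes
   two such families agree one dimension at a time, at the price of compositions over
   some D_l with l > j.  The same dimension-by-dimension comparison shows that the
   iterated unit on a cell u is good iff the iterated unit on the source of u is, so
   goodness of all cells of positive dimension reduces to that of the iterated units on
   objects. *)

From Stdlib Require Import Relations.Relation_Operators ClassicalEpsilon.
From mathcomp Require Import all_boot.
Require Import Defs.

Set Implicit Arguments.
Unset Strict Implicit.
Unset Printing Implicit Defensive.

(** * Iterated boundaries, parallel cells and representable groupoids *)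

Section Boundaries.
Variables (C : GlobExt).
Implicit Types G H : Presheaf C.

Definition bd G (b : bool) l m (h : l < m) (x : cell G m) : cell G l :=
  PM G (gl b h) x.

Lemma bd_bd G b b' k l m (h1 : k < l) (h2 : l < m) (h3 : k < m) (x : cell G m) :
  bd b h1 (bd b' h2 x) = bd b h3 x.
Proof. by rewrite /bd -PM_comp (gl_comp C b b' h1 h2 h3). Qed.

Lemma bd_irr G b l m (h h' : l < m) (x : cell G m) : bd b h x = bd b h' x.
Proof. by rewrite (bool_irrelevance h h'). Qed.

Lemma pm_bd G H (f : PMor G H) b l m (h : l < m) (x : cell G m) :
  pm f (bd b h x) = bd b h (pm f x).
Proof. exact: pm_nat. Qed.

(** Comparing the boundaries in every lower dimension avoids a case split on [m = 0]; the top source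
    and target already determine the rest. *)
Definition par G m (x y : cell G m) : Prop :=
  forall b l (h : l < m), bd b h x = bd b h y.

Lemma par_refl G m (x : cell G m) : par x x.
Proof. by []. Qed.

Lemma par_sym G m (x y : cell G m) : par x y -> par y x.
Proof. by move=> e b l h; rewrite e. Qed.

Lemma par_trans G m (y x z : cell G m) : par x y -> par y z -> par x z.
Proof. by move=> e e' b l h; rewrite e e'. Qed.

Lemma par_top G m (x y : cell G m.+1) :
  (forall b, bd b (ltnSn m) x = bd b (ltnSn m) y) -> par x y.
Proof.
move=> e b l h; have := h; rewrite ltnS leq_eqVlt => /orP[/eqP el|hl]; first by subst l; rewrite !(bd_irr b h (ltnSn m)).
by rewrite -!(bd_bd b true hl (ltnSn m)) e.
Qed.

Lemma parallelP G m (x y : cell G m) : parallel G m x y <-> par x y.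
Proof.
case: m x y => [|m] x y; first by split=> // _ b l.
split=> [[es et]|e]; last by split; apply: e.
by apply: par_top; case.
Qed.

Lemma par_pm G H (f : PMor G H) m (x y : cell G m) : par x y -> par (pm f x) (pm f y).
Proof. by move=> e b l h; rewrite -!pm_bd e. Qed.

Lemma sim_par G m (x y : cell G m) : sim x y -> par x y.
Proof.
move=> [a [<- <-]] b l h; rewrite /src /tgt.
have h' : l < m.+1 by apply: ltnW.
by rewrite [LHS](bd_bd b true h (ltnSn m) h') [RHS](bd_bd b false h (ltnSn m) h').
Qed.

Lemma sim_pm G H (f : PMor G H) m (x y : cell G m) : sim x y -> sim (pm f x) (pm f y).
Proof.
by move=> [a [<- <-]]; exists (pm f a); rewrite /src /tgt -!pm_nat.
Qed.

(** An [n]-cell of the representable presheaf [yon X] is a morphism from [D n] to [X], so lemmas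
    about cells also apply to the operations themselves. Through [yev], the Yoneda map, a relation
    proved for universal cells passes to the cells of any [G]. *)
Definition yon (X : C) : Presheaf C :=
  @MkPresheaf C (fun a => Hom a X) (fun a b g x => comp x g)
    (fun a x => comp_id_r x) (fun a b c g h x => comp_assoc g h x).

Definition yev G (X : C) (xi : PO G X) : PMor (yon X) G :=
  @MkPMor C (yon X) G (fun a g => PM G g xi) (fun a b g x => PM_comp g x xi).

(** This is the universal property of the globular sums, read through morphisms into [X]. *)
Lemma yon_infty_groupoid (X : C) : is_infty_groupoid (yon X).
Proof.
move=> T; have [cc un] := gsum_colim C T; split=> [x y e|u e].
  have cy : cocone (fun k => comp y (ginj T k)).
    by move=> k; rewrite -!comp_assoc cc.
  have [h [_ hu]] := un X _ cy.
  by rewrite (hu x e) (hu y).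
by have [h [hh _]] := un X u e; exists h.
Qed.

Lemma contractible_sim (HC : contractible C) T n (x y : cell (yon (gsum T)) n) :
  tdimension T <= n.+1 -> par x y -> sim x y.
Proof.
move=> hT /parallelP e; case: (HC T n x y hT) => [|h [hs ht]]; last by exists h.
by case: n x y hT e.
Qed.

Lemma gls_ex j l m (hl : j < l) (hm : j < m) b (h : l < m) :
  exists phi : Hom (@gsum C (T2 hl)) (gsum (T2 hm)),
    forall k : 'I_2, comp phi (ginj (T2 hl) k) = comp (ginj (T2 hm) k) (gl b h).
Proof.
have [_ un] := gsum_colim C (T2 hl).
have [|phi [hphi _]] := un _ (fun k : 'I_2 => comp (ginj (T2 hm) k : Hom (D m) _) (gl b h)).
  move=> k; have [cm _] := gsum_colim C (T2 hm).
  rewrite /= -!comp_assoc !(gl_comp C _ _ _ _ hm); exact: (cm k).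
by exists phi.
Qed.

(** This is $\sigma^m_l\amalg_{D_j}\sigma^m_l$ when [b] is [true] and $\tau^m_l\amalg_{D_j}\tau^m_l$
    otherwise. *)
Definition gls j l m (hl : j < l) (hm : j < m) b (h : l < m) :
    Hom (@gsum C (T2 hl)) (gsum (T2 hm)) :=
  proj1_sig (constructive_indefinite_description _ (gls_ex hl hm b h)).

Lemma glsE j l m (hl : j < l) (hm : j < m) b (h : l < m) (k : 'I_2) :
  comp (gls hl hm b h) (ginj (T2 hl) k) = comp (ginj (T2 hm) k) (gl b h).
Proof. by rewrite /gls; case: constructive_indefinite_description. Qed.

Lemma gls_comp j k l m (hk : j < k) (hl : j < l) (hm : j < m) b b'
    (h1 : k < l) (h2 : l < m) (h3 : k < m) :
  comp (gls hl hm b' h2) (gls hk hl b h1) = gls hk hm b h3.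
Proof.
apply: (proj1 (yon_infty_groupoid (gsum (T2 hm)) (T2 hk))) => /= i.
by rewrite -comp_assoc !glsE comp_assoc glsE -comp_assoc (gl_comp C _ _ _ _ h3).
Qed.

End Boundaries.

(** * Compositions, reversals and iterated units *)

Section Operations.
Variables (C : GlobExt) (P : pregroupoidal C).
Implicit Types G H : Presheaf C.

Definition composable G j m (h : j < m) (v u : cell G m) : Prop :=
  bd true h v = bd false h u.

Lemma ginj_composable G j m (h : j < m) (xi : PO G (gsum (T2 h))) :
  composable h (PM G (ginj (T2 h) eps1) xi : cell G m) (PM G (ginj (T2 h) eps2) xi).
Proof.
have [cc _] := gsum_colim C (T2 h).
pose e (k : 'I_2) : Hom (D m) (@gsum C (T2 h)) := ginj (T2 h) k.
have ec : comp (e (widen_ord (leqnSn 1) ord0)) (gl true h)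
    = comp (e (lift ord0 ord0)) (gl false h) := cc ord0.
rewrite /composable /bd -!PM_comp.
change (PM G (comp (e eps1) (gl true h)) xi = PM G (comp (e eps2) (gl false h)) xi).
rewrite (_ : eps1 = widen_ord (leqnSn 1) ord0); last exact: val_inj.
rewrite ec; congr (PM _ (comp (e _) _) _); exact: val_inj.
Qed.

Lemma pair_ex G (HG : is_infty_groupoid G) j m (h : j < m) (v u : cell G m) :
  composable h v u ->
  exists xi : PO G (gsum (T2 h)),
    PM G (ginj (T2 h) eps1) xi = v /\ PM G (ginj (T2 h) eps2) xi = u.
Proof.
move=> c.
have [_ ex] := HG (T2 h).
have [|xi hxi] := ex (fun k : 'I_2 => if k == 0 :> nat then v else u).
  by move=> k /=; rewrite (ord1 k).
by exists xi; rewrite !hxi.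
Qed.

Lemma pair_uniq G (HG : is_infty_groupoid G) j m (h : j < m) (xi xi' : PO G (gsum (T2 h))) :
  PM G (ginj (T2 h) eps1) xi = PM G (ginj (T2 h) eps1) xi' ->
  PM G (ginj (T2 h) eps2) xi = PM G (ginj (T2 h) eps2) xi' -> xi = xi'.
Proof.
move=> e1 e2; apply: (proj1 (HG (T2 h))) => k.
case: k => -[|[|//]] p.
  by rewrite (_ : Ordinal p = eps1) //; apply: val_inj.
by rewrite (_ : Ordinal p = eps2) //; apply: val_inj.
Qed.

(* Junk unless [composable h v u]. *)
Definition cmp G j m (h : j < m) (v u : cell G m) : cell G m :=
  epsilon (inhabits v) (comp_rel P G h v u).

Lemma comp_rel_fun G (HG : is_infty_groupoid G) j m (h : j < m) (v u w w' : cell G m) :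
  comp_rel P G h v u w -> comp_rel P G h v u w' -> w = w'.
Proof.
move=> [x [x1 [x2 <-]]] [y [y1 [y2 <-]]]; congr (PM _ _ _).
by apply: (pair_uniq HG); rewrite ?x1 ?x2 ?y1 ?y2.
Qed.

Lemma cmp_rel G (HG : is_infty_groupoid G) j m (h : j < m) (v u : cell G m) :
  composable h v u -> comp_rel P G h v u (cmp h v u).
Proof.
move=> c; apply: epsilon_spec; have [xi [e1 e2]] := pair_ex HG c.
by exists (PM G (nabla P h) xi), xi.
Qed.

Lemma cmpE G (HG : is_infty_groupoid G) j m (h : j < m) (v u w : cell G m) :
  comp_rel P G h v u w -> cmp h v u = w.
Proof.
move=> r; apply: comp_rel_fun (r) => //; apply: cmp_rel => //.
by case: r => xi [<- [<- _]]; apply: ginj_composable.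
Qed.

Lemma comp_rel_pm G H (f : PMor G H) j m (h : j < m) (v u w : cell G m) :
  comp_rel P G h v u w -> comp_rel P H h (pm f v) (pm f u) (pm f w).
Proof.
by move=> [xi [<- [<- <-]]]; exists (pm f xi); rewrite !pm_nat.
Qed.

Lemma composable_pm G H (f : PMor G H) j m (h : j < m) (v u : cell G m) :
  composable h v u -> composable h (pm f v) (pm f u).
Proof. by rewrite /composable -!pm_bd => ->. Qed.

Lemma pm_cmp G H (HG : is_infty_groupoid G) (HH : is_infty_groupoid H) (f : PMor G H)
    j m (h : j < m) (v u : cell G m) :
  composable h v u -> pm f (cmp h v u) = cmp h (pm f v) (pm f u).
Proof.
by move=> c; symmetry; apply: cmpE => //; apply/comp_rel_pm/cmp_rel.
Qed.

Definition inv G j m (h : j < m) (v : cell G m) : cell G m := PM G (wrev P h) v.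

Lemma pm_inv G H (f : PMor G H) j m (h : j < m) (v : cell G m) :
  pm f (inv h v) = inv h (pm f v).
Proof. exact: pm_nat. Qed.

Lemma inv_bd G b j l m (h : j < m) (hl : l < m) (hj : j < l) (v : cell G m) :
  bd b hl (inv h v) = inv hj (bd b hl v).
Proof.
elim: m h hl v => // m IH h hl v.
have top (h' : j < m) : bd b (ltnSn m) (inv h v) = inv h' (bd b (ltnSn m) v).
  by clear IH; rewrite /bd /inv -!PM_comp; case: b; rewrite ?(wrev_s P h h') ?(wrev_t P h h').
have := hl; rewrite ltnS leq_eqVlt => /orP[/eqP el|hlm].
  by subst l; rewrite !(bd_irr b hl (ltnSn m)).
have hjm : j < m by apply: ltn_trans hlm.
by rewrite -!(bd_bd b b hlm (ltnSn m) hl) (top hjm) IH.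
Qed.

Lemma inv_bd_same G b j m (h : j < m) (v : cell G m) :
  bd b h (inv h v) = bd (~~ b) h v.
Proof.
elim: m h v => // m IH h v.
have := h; rewrite ltnS leq_eqVlt => /orP[/eqP el|hjm].
  subst j; clear IH; rewrite !(bd_irr _ h (ltnSn m)) /bd /inv -!PM_comp.
  by case: b; rewrite ?(wrev_s1 P h) ?(wrev_t1 P h).
rewrite -(bd_bd b b hjm (ltnSn m) h) -(bd_bd (~~ b) b hjm (ltnSn m) h).
by rewrite (inv_bd b h (ltnSn m) hjm) IH.
Qed.

Section InfGpd.
Variables (G : Presheaf C) (HG : is_infty_groupoid G).

Lemma nabla_gls b j m (h : j < m.+1) (h' : j < m) :
  comp (nabla P h) (gl b (ltnSn m)) = comp (gls C h' h b (ltnSn m)) (nabla P h').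
Proof. by case: b; [apply: nabla_s|apply: nabla_t] => k; apply: glsE. Qed.

Lemma cmp_bd_top b j m (h : j < m.+1) (h' : j < m) (v u : cell G m.+1) :
  composable h v u ->
  bd b (ltnSn m) (cmp h v u) = cmp h' (bd b (ltnSn m) v) (bd b (ltnSn m) u).
Proof.
move=> /(cmp_rel HG)[xi [ev [eu <-]]]; symmetry; apply: cmpE => //.
exists (PM G (gls C h' h b (ltnSn m)) xi); rewrite /bd -!PM_comp !glsE nabla_gls.
by rewrite !PM_comp ev eu.
Qed.

Lemma cmp_bd_same j m (h : j < m) (v u : cell G m) :
  composable h v u ->
  bd true h (cmp h v u) = bd true h u /\ bd false h (cmp h v u) = bd false h v.
Proof.
elim: m h v u => // m IH h v u c.
have := h; rewrite ltnS leq_eqVlt => /orP[/eqP el|hjm].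
  subst j; have [xi [ev [eu <-]]] := cmp_rel HG c.
  rewrite -ev -eu !(bd_irr _ h (ltnSn m)) /bd -!PM_comp.
  by rewrite -(nabla_s1 P h) -(nabla_t1 P h).
have c' b : composable hjm (bd b (ltnSn m) v) (bd b (ltnSn m) u).
  by rewrite /composable !(bd_bd _ _ _ _ h).
rewrite -!(bd_bd _ true hjm (ltnSn m) h) (cmp_bd_top true hjm c).
exact: IH.
Qed.

Lemma cmp_bd b j l m (h : j < m) (hl : l < m) (hj : j < l) (v u : cell G m) :
  composable h v u -> bd b hl (cmp h v u) = cmp hj (bd b hl v) (bd b hl u).
Proof.
elim: m h hl v u => // m IH h hl v u c.
have := hl; rewrite ltnS leq_eqVlt => /orP[/eqP el|hlm].
  by subst l; rewrite !(bd_irr b hl (ltnSn m)); apply: cmp_bd_top.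
have hjm : j < m by apply: ltn_trans hlm.
rewrite -!(bd_bd b b hlm (ltnSn m) hl) (cmp_bd_top b hjm c) IH //.
by rewrite /composable !(bd_bd _ _ _ _ h).
Qed.

Lemma cmp_bd_low b j l m (h : j < m) (hl : l < m) (hj : l < j) (v u : cell G m) :
  composable h v u -> bd b hl (cmp h v u) = bd b hl u.
Proof.
by move=> c; rewrite -!(bd_bd b true hj h hl) (proj1 (cmp_bd_same c)).
Qed.

Lemma composable_par j m (h : j < m) (v v' u u' : cell G m) :
  par v v' -> par u u' -> composable h v u -> composable h v' u'.
Proof. by move=> ev eu; rewrite /composable ev eu. Qed.

Lemma cmp_par j m (h : j < m) (v v' u u' : cell G m) :
  par v v' -> par u u' -> composable h v u -> par (cmp h v u) (cmp h v' u').
Proof.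
move=> ev eu c b l hl; have c' := composable_par ev eu c.
case: (ltngtP l j) => hj.
- by rewrite !(cmp_bd_low _ _ hj) // eu.
- by rewrite !(cmp_bd _ _ hj) // ev eu.
subst l; rewrite (bool_irrelevance hl h).
have [es et] := cmp_bd_same c; have [es' et'] := cmp_bd_same c'.
by case: b; rewrite ?es ?et ?es' ?et' ?ev ?eu.
Qed.

(** The [m.+1]-cells that witness the two relations are composable over the same [D j], since their
    [j]-boundaries are those of the cells they join. *)
Lemma sim_cmp j m (h : j < m) (v v' u u' : cell G m) :
  sim v v' -> sim u u' -> composable h v u -> sim (cmp h v u) (cmp h v' u').
Proof.
move=> [a [<- <-]] [b [<- <-]] c.
have h' : j < m.+1 by apply: ltnW.
exists (cmp h' a b).
have c' : composable h' a b.
  by rewrite /composable -(bd_bd true true h (ltnSn m)) -(bd_bd false true h (ltnSn m)).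
by split; [apply: (cmp_bd true)|apply: (cmp_bd false)].
Qed.

Lemma kunit_bd b m (x : cell G m) : bd b (ltnSn m) (kunit P G x) = x.
Proof.
by rewrite /bd /kunit -PM_comp; case: b; rewrite (kappa_s, kappa_t) PM_id.
Qed.

Lemma sim_refl m (x : cell G m) : sim x x.
Proof. by exists (kunit P G x); split; [apply: (kunit_bd true)|apply: (kunit_bd false)]. Qed.

Lemma sim_sym m (x y : cell G m) : sim x y -> sim y x.
Proof.
move=> [a [<- <-]]; exists (inv (ltnSn m) a).
by split; [apply: (inv_bd_same true)|apply: (inv_bd_same false)].
Qed.

Lemma sim_trans m (y x z : cell G m) : sim x y -> sim y z -> sim x z.
Proof.
move=> [a [<- ea]] [b [eb <-]]; exists (cmp (ltnSn m) b a).
by have [|es et] := @cmp_bd_same _ _ (ltnSn m) b a; first exact: etrans eb (esym ea).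
Qed.

(** Units, reversals and composites in codimension one make [sim] itself an equivalence relation, so
    the generated one adds nothing. *)
Lemma simeqP m (x y : cell G m) : simeq G m x y <-> sim x y.
Proof.
split; last exact: rst_step.
elim=> {x y} [//|x|x y _ /sim_sym //|x y z _ xy _]; first exact: sim_refl.
exact: sim_trans.
Qed.

End InfGpd.

(* Meaningful only for [l <= m]. *)
Fixpoint kap m l : Hom (@D C m) (@D C l) :=
  match m with
  | 0 => match l with 0 => idm _ | l'.+1 => gl true (ltn0Sn l') end
  | m'.+1 => match eq_comparable m'.+1 l with
             | left e => eq_rect m'.+1 (fun i => Hom (D m'.+1) (D i)) (idm _) l e
             | right _ => comp (kap m' l) (kappa P m')
             end
  end.

Lemma kap_id m : kap m m = idm _.
Proof.
case: m => //= m; case: eq_comparable => // e.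
by rewrite (eq_axiomK e).
Qed.

Lemma kapS l m : l <= m -> kap m.+1 l = comp (kap m l) (kappa P m).
Proof.
by move=> h /=; case: eq_comparable => // e; exfalso; move: h; rewrite -e ltnn.
Qed.

Lemma kap_gl b l m m' (h : m < m') : l <= m -> comp (kap m' l) (gl b h) = kap m l.
Proof.
move=> hl; elim: m' h => // m' IH h.
have hl' : l <= m' by apply: leq_trans hl _.
have top b' : comp (kap m'.+1 l) (gl b' (ltnSn m')) = kap m' l.
  rewrite kapS // -comp_assoc.
  by case: b'; rewrite (kappa_s, kappa_t) comp_id_r.
have := h; rewrite ltnS leq_eqVlt => /orP[/eqP e|hm].
  by subst m'; rewrite (bool_irrelevance h (ltnSn m)).
by rewrite -(gl_comp C b true hm (ltnSn m') h) comp_assoc top IH.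
Qed.

Lemma kap_gl_low b l m (h : l < m) : comp (kap m l.+1) (gl b h) = gl b (ltnSn l).
Proof.
have := h; rewrite leq_eqVlt => /orP[/eqP e|hm].
  by subst m; rewrite kap_id comp_id_l (bool_irrelevance h (ltnSn l)).
by rewrite -(gl_comp C b b (ltnSn l) hm h) comp_assoc kap_gl // kap_id comp_id_l.
Qed.

Definition kup G l m (x : cell G l) : cell G m := PM G (kap m l) x.

Lemma pm_kup G H (f : PMor G H) l m (x : cell G l) : pm f (kup m x) = kup m (pm f x).
Proof. exact: pm_nat. Qed.

Lemma kup_bd G b l m m' (h : m < m') (x : cell G l) :
  l <= m -> bd b h (kup m' x) = kup m x.
Proof. by move=> hl; rewrite /bd /kup -PM_comp kap_gl. Qed.

Lemma kup_id G l (x : cell G l) : kup l x = x.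
Proof. by rewrite /kup kap_id PM_id. Qed.

Lemma kup_bd_low G b l m (h : l < m) (x : cell G l.+1) :
  bd b h (kup m x) = bd b (ltnSn l) x.
Proof. by rewrite /bd /kup -PM_comp kap_gl_low. Qed.

Lemma kit_kup G m (x : cell G 0) : kit P G m x = kup m x.
Proof.
elim: m => [|m IH]; first by rewrite kup_id.
by rewrite /kup kapS // PM_comp -/(kup m x) -IH.
Qed.

End Operations.

(** * The division lemma *)

Section Division.
Variables (C : GlobExt) (P : pregroupoidal C) (HC : contractible C).

Lemma tdimension_T2 j m (h : j < m) : tdimension (T2 h) <= m.+1.
Proof. by apply/bigmax_leqP => k _ /=. Qed.

(** Bijectivity of [p] from the classes parallel to [a] to those parallel to [p a], phrased on
    representatives so that no quotient is formed. *)
Record division (G : Presheaf C) n (a : cell G n) (p : cell G n -> cell G n) : Prop := {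
  division_par : forall x, par a x -> par (p a) (p x);
  division_sim : forall x y, par a x -> sim x y -> sim (p x) (p y);
  division_inj : forall x y, par a x -> par a y -> sim (p x) (p y) -> sim x y;
  division_surj : forall c, par (p a) c -> exists2 x, par a x & sim (p x) c }.

Section Chain.
Variables (G : Presheaf C) (HG : is_infty_groupoid G).

(** A common index type [X] allows two maps to be compared although their values may lie in
    different parallel classes. *)
Definition bij_on X (E : X -> X -> Prop) n (g : X -> cell G n) : Prop :=
  (forall x y, sim (g x) (g y) -> E x y) /\
  (forall x c, par (g x) c -> exists y, sim (g y) c).

Lemma bij_on_division X (E : X -> X -> Prop) n (g : X -> cell G n) p :
  (forall x y, par (g x) (g y)) -> (forall x, division (g x) p) ->
  bij_on E (fun x => p (g x)) <-> bij_on E g.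
Proof.
move=> gpar dp; split=> -[inj surj]; split.
- by move=> x y e; apply: inj; apply: (division_sim (dp x)).
- move=> x c e; have [y ey] := surj x (p c) (division_par (dp x) e).
  by exists y; apply: (division_inj (dp x)).
- by move=> x y e; apply: inj; apply: (division_inj (dp x)).
move=> x c e; have [z ez ezc] := division_surj (dp x) e.
have [y ey] := surj x z ez; exists y.
by apply: (sim_trans P HG _ ezc); apply: (division_sim (dp x)).
Qed.

Lemma bij_on_sim X (E : X -> X -> Prop) n (g g' : X -> cell G n) :
  (forall x, sim (g x) (g' x)) -> bij_on E g -> bij_on E g'.
Proof.
move=> e [inj surj]; split=> [x y exy|x c ec].
  apply: inj; apply: (sim_trans P HG) (e x) _; apply: (sim_trans P HG) exy _.
  exact/(sim_sym P)/e.
have [y ey] := surj x c (par_trans (sim_par (e x)) ec).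
by exists y; apply: (sim_trans P HG) ey; apply/(sim_sym P)/e.
Qed.

Lemma bij_on_ext X (E : X -> X -> Prop) n (g g' : X -> cell G n) :
  (forall x, g x = g' x) -> bij_on E g <-> bij_on E g'.
Proof. by move=> e; split; apply: bij_on_sim => x; rewrite e; apply: sim_refl. Qed.

Definition left_division j n (h : j < n) : Prop :=
  forall v a : cell G n, composable h v a -> division a (cmp P h v).
Definition right_division j n (h : j < n) : Prop :=
  forall v a : cell G n, composable h a v -> division a (fun x => cmp P h x v).

(** An operation on pairs composable over [D j], in all dimensions above [j] at once. *)
Definition family j := forall m (h : j < m), Hom (@D C m) (gsum (T2 h)).

(** Compatibility with boundaries is asked only from dimension [l] on, because whiskering over [D l]
    produces families that make sense only above [l]. *)
Definition coherent j l (g : family j) : Prop :=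
  forall m m' (h : j < m) (h' : j < m') (hm : m < m') b, l <= m ->
    comp (g m' h') (gl b hm) = comp (gls C h h' b hm) (g m h).

(* Two coherent families agreeing below level [l] are made to agree at level [l]
   by whiskering them with a cell joining their members of dimension [l]. *)
Lemma chain j n (hn : j < n) X (E : X -> X -> Prop) (x0 : X)
    (xi : X -> PO G (gsum (T2 hn))) :
  (forall x y b l (h : l < n) (hl : j < l),
     PM G (gls C hl hn b h) (xi x) = PM G (gls C hl hn b h) (xi y)) ->
  (forall l (h : l < n), j < l -> left_division h /\ right_division h) ->
  forall d l (g g' : family j) (hl : j < l), l + d = n ->
  coherent l g -> coherent l g' -> par (g l hl : cell (yon _) l) (g' l hl) ->
  (forall x y, par (PM G (g n hn) (xi x) : cell G n) (PM G (g n hn) (xi y))) ->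
  (forall x y, par (PM G (g' n hn) (xi x) : cell G n) (PM G (g' n hn) (xi y))) ->
  bij_on E (fun x => PM G (g n hn) (xi x) : cell G n) <->
  bij_on E (fun x => PM G (g' n hn) (xi x) : cell G n).
Proof.
move=> xib divs; elim=> [|d IH] l g g' hl.
  (* At level [n] the two members are parallel cells of the universal pair; contractibility joins
     them, and evaluation at [xi x] joins their values. *)
  rewrite addn0 => el; subst l => _ _; rewrite (bool_irrelevance hl hn) => e _ _.
  have s := contractible_sim HC (tdimension_T2 hn) e.
  split; apply: bij_on_sim => x; first exact: (sim_pm (yev (xi x))).
  by apply: (sim_sym P); apply: (sim_pm (yev (xi x))).
rewrite addnS -addSn => en cg cg' e gp gp'.
have hln : l < n by rewrite -en leq_addr.
have [c [cs ct]] := contractible_sim HC (tdimension_T2 hl) e.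
(* [w b] applies [c] to the [l]-sources ([b = true]) or [l]-targets of the pair and raises the
   result to dimension [m] by units. It goes from the value of [g] to that of [g'] on this
   boundary. *)
pose w b m (h : l < m) (hm : j < m) : Hom (D m) (gsum (T2 hm)) :=
  comp (comp (gls C hl hm b h) c) (kap P m l.+1).
have w_low b b' m (h : l < m) (hm : j < m) :
    comp (w b m h hm) (gl b' h)
    = comp (gls C hl hm b h) (if b' then g l hl else g' l hl).
  rewrite -comp_assoc kap_gl_low -comp_assoc; congr comp.
  by case: b'.
have w_bd b b' m m' (h : l < m) (h' : l < m') (hm : j < m) (hm' : j < m') (hmm : m < m') :
    comp (w b m' h' hm') (gl b' hmm) = comp (gls C hm hm' b' hmm) (w b m h hm).
  rewrite -comp_assoc kap_gl // !comp_assoc.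
  by rewrite (gls_comp C hl hm hm' b b' h hmm h').
have cL m (h : l < m) (hm : j < m) :
    composable h (w false m h hm : cell (yon _) m) (g m hm).
  rewrite /composable /bd /= w_low.
  by rewrite (cg _ _ hl).
have cR m (h : l < m) (hm : j < m) :
    composable h (g' m hm : cell (yon _) m) (w true m h hm).
  rewrite /composable /bd /= w_low.
  by rewrite (cg' _ _ hl).
have [g1 g1E] : exists g1 : family j, forall m (hm : j < m) (h : l < m),
    g1 m hm = cmp P (G := yon _) h (w false m h hm) (g m hm).
  (* A family has a member for each [m > j], whereas composing over [D l] requires [l < m]; the
     default value lies outside the range of [coherent l.+1]. *)
  exists (fun m hm => match Bool.bool_dec (l < m) true with
     | left h => cmp P (G := yon _) h (w false m h hm) (g m hm)
     | right _ => g m hm end) => m hm h.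
  by case: Bool.bool_dec => // h'; rewrite (bool_irrelevance h' h).
have [g2 g2E] : exists g2 : family j, forall m (hm : j < m) (h : l < m),
    g2 m hm = cmp P (G := yon _) h (g' m hm) (w true m h hm).
  exists (fun m hm => match Bool.bool_dec (l < m) true with
     | left h => cmp P (G := yon _) h (g' m hm) (w true m h hm)
     | right _ => g' m hm end) => m hm h.
  by case: Bool.bool_dec => // h'; rewrite (bool_irrelevance h' h).
have yG Y := yon_infty_groupoid (C := C) Y.
have cg1 : coherent l.+1 g1.
  move=> m m' h h' hm b lm; have lm' := ltn_trans lm hm.
  rewrite (g1E _ _ lm) (g1E _ _ lm').
  rewrite -[LHS]/(bd b hm (cmp P (G := yon _) lm' _ _)) (cmp_bd P (yG _) b hm lm (cL _ _ _)).
  rewrite -[RHS]/(pm (yev (gls C h h' b hm : PO (yon _) _)) (cmp P (G := yon _) lm _ _)).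
  rewrite (pm_cmp P (yG _) (yG _) _ (cL _ _ _)) /bd /= (w_bd _ _ _ _ lm) (cg _ _ h) //.
  exact: ltnW.
have cg2 : coherent l.+1 g2.
  move=> m m' h h' hm b lm; have lm' := ltn_trans lm hm.
  rewrite (g2E _ _ lm) (g2E _ _ lm').
  rewrite -[LHS]/(bd b hm (cmp P (G := yon _) lm' _ _)) (cmp_bd P (yG _) b hm lm (cR _ _ _)).
  rewrite -[RHS]/(pm (yev (gls C h h' b hm : PO (yon _) _)) (cmp P (G := yon _) lm _ _)).
  rewrite (pm_cmp P (yG _) (yG _) _ (cR _ _ _)) /bd /= (w_bd _ _ _ _ lm) (cg' _ _ h) //.
  exact: ltnW.
(* As in a naturality square, both composites go from [g] on the [l]-sources to [g'] on the
   [l]-targets. *)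
have par12 (hl1 : j < l.+1) : par (g1 l.+1 hl1 : cell (yon _) l.+1) (g2 l.+1 hl1).
  apply: par_top => b; rewrite (g1E _ _ (ltnSn l)) (g2E _ _ (ltnSn l)).
  have [s1 t1] := cmp_bd_same P (yG _) (cL _ (ltnSn l) hl1).
  have [s2 t2] := cmp_bd_same P (yG _) (cR _ (ltnSn l) hl1).
  case: b; rewrite ?s1 ?t1 ?s2 ?t2 /bd /= w_low.
    exact: (cg _ _ hl).
  by symmetry; apply: (cg' _ _ hl).
have [dL dR] := divs l hln hl.
pose W b x : cell G n := PM G (w b n hln hn) (xi x).
(* The whiskering cell depends only on the [l]-boundaries of the pair, which do not vary with [x].
   On values the whiskering is thus composition with one fixed cell, a division by [divs]. *)
have Wc b x y : W b x = W b y by rewrite /W !PM_comp (xib x y).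
have evL x : PM G (g1 n hn) (xi x) = cmp P hln (W false x) (PM G (g n hn) (xi x)).
  by rewrite (g1E _ _ hln) -(pm_cmp P (yG _) HG (yev (xi x)) (cL _ _ _)).
have evR x : PM G (g2 n hn) (xi x) = cmp P hln (PM G (g' n hn) (xi x)) (W true x).
  by rewrite (g2E _ _ hln) -(pm_cmp P (yG _) HG (yev (xi x)) (cR _ _ _)).
have cLx x y : composable hln (W false x) (PM G (g n hn) (xi y)).
  by rewrite (Wc _ x y); apply: (composable_pm (yev (xi y)) (cL _ _ _)).
have cRx x y : composable hln (PM G (g' n hn) (xi y)) (W true x).
  by rewrite (Wc _ x y); apply: (composable_pm (yev (xi y)) (cR _ _ _)).
have evL0 x : PM G (g1 n hn) (xi x) = cmp P hln (W false x0) (PM G (g n hn) (xi x)).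
  by rewrite evL (Wc _ x x0).
have evR0 x : PM G (g2 n hn) (xi x) = cmp P hln (PM G (g' n hn) (xi x)) (W true x0).
  by rewrite evR (Wc _ x x0).
rewrite -(bij_on_division _ gp (fun x => dL _ _ (cLx x0 x))).
rewrite -(bij_on_division _ gp' (fun x => dR _ _ (cRx x0 x))).
rewrite -(bij_on_ext E evL0) -(bij_on_ext E evR0).
apply: (IH l.+1 g1 g2 (ltnW hl)) => // x y.
  by rewrite !evL0; apply: cmp_par => //; apply: cLx.
by rewrite !evR0; apply: cmp_par => //; apply: cRx.
Qed.

(** * Undoing a composition by means of reversals *)

Section Retractions.
Variables (H : Presheaf C) (HH : is_infty_groupoid H).

(** The value is parallel to [u] in dimension [j.+1] but need not be so above, which is why [chain],
    and not a single lifting, relates it to [u]. *)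
Definition lret j m (h : j < m) (v u : cell H m) := cmp P h (inv P h v) (cmp P h v u).
Definition rret j m (h : j < m) (u v : cell H m) := cmp P h (cmp P h u v) (inv P h v).

Lemma composable_invl j m (h : j < m) (v u : cell H m) :
  composable h v u -> composable h (inv P h v) (cmp P h v u).
Proof. by move=> c; rewrite /composable inv_bd_same (proj2 (cmp_bd_same P HH c)). Qed.

Lemma composable_invr j m (h : j < m) (u v : cell H m) :
  composable h u v -> composable h (cmp P h u v) (inv P h v).
Proof. by move=> c; rewrite /composable inv_bd_same (proj1 (cmp_bd_same P HH c)). Qed.

Lemma lret_bd b j l m (h : j < m) (hl : l < m) (hj : j < l) (v u : cell H m) :
  composable h v u -> bd b hl (lret h v u) = lret hj (bd b hl v) (bd b hl u).
Proof.
move=> c; rewrite (cmp_bd P HH b hl hj (composable_invl c)).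
by rewrite (cmp_bd P HH b hl hj c) (inv_bd P b h hl hj).
Qed.

Lemma rret_bd b j l m (h : j < m) (hl : l < m) (hj : j < l) (u v : cell H m) :
  composable h u v -> bd b hl (rret h u v) = rret hj (bd b hl u) (bd b hl v).
Proof.
move=> c; rewrite (cmp_bd P HH b hl hj (composable_invr c)).
by rewrite (cmp_bd P HH b hl hj c) (inv_bd P b h hl hj).
Qed.

Lemma lret_par_top j (v u : cell H j.+1) :
  composable (ltnSn j) v u -> par (lret (ltnSn j) v u) u.
Proof.
move=> c; apply: par_top => b.
have [s1 t1] := cmp_bd_same P HH (composable_invl c).
have [s2 t2] := cmp_bd_same P HH c.
by case: b; rewrite ?s1 ?t1 ?s2 ?inv_bd_same.
Qed.

Lemma rret_par_top j (u v : cell H j.+1) :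
  composable (ltnSn j) u v -> par (rret (ltnSn j) u v) u.
Proof.
move=> c; apply: par_top => b.
have [s1 t1] := cmp_bd_same P HH (composable_invr c).
have [s2 t2] := cmp_bd_same P HH c.
by case: b; rewrite ?s1 ?t1 ?t2 ?inv_bd_same.
Qed.

Lemma pm_lret G' (HG' : is_infty_groupoid G') (f : PMor H G') j m (h : j < m) (v u : cell H m) :
  composable h v u -> pm f (lret h v u) = cmp P h (inv P h (pm f v)) (cmp P h (pm f v) (pm f u)).
Proof.
by move=> c; rewrite (pm_cmp P HH HG' f (composable_invl c)) (pm_cmp P HH HG' f c) pm_inv.
Qed.

Lemma pm_rret G' (HG' : is_infty_groupoid G') (f : PMor H G') j m (h : j < m) (u v : cell H m) :
  composable h u v -> pm f (rret h u v) = cmp P h (cmp P h (pm f u) (pm f v)) (inv P h (pm f v)).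
Proof.
by move=> c; rewrite (pm_cmp P HH HG' f (composable_invr c)) (pm_cmp P HH HG' f c) pm_inv.
Qed.

End Retractions.

Lemma gls_par j l n (hl : j < l) (hn : j < n) b (h : l < n) (x y : PO G (gsum (T2 hn))) :
  par (PM G (ginj (T2 hn) eps1) x : cell G n) (PM G (ginj (T2 hn) eps1) y) ->
  par (PM G (ginj (T2 hn) eps2) x : cell G n) (PM G (ginj (T2 hn) eps2) y) ->
  PM G (gls C hl hn b h) x = PM G (gls C hl hn b h) y.
Proof.
move=> e1 e2; apply: (pair_uniq HG); rewrite -!PM_comp !glsE !PM_comp.
  exact: e1.
exact: e2.
Qed.

(** The operation that returns one member of the pair, against which the retractions are
    compared. *)
Definition ginj_family j (k : 'I_2) : family j := fun m h => ginj (T2 h) k.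

Definition lret_family j : family j :=
  fun m h => lret (H := yon _) h (ginj (T2 h) eps1) (ginj (T2 h) eps2).

Definition rret_family j : family j :=
  fun m h => rret (H := yon _) h (ginj (T2 h) eps1) (ginj (T2 h) eps2).

Lemma ginj_composable_yon j m (h : j < m) :
  composable h (ginj (T2 h) eps1 : cell (yon (@gsum C (T2 h))) m) (ginj (T2 h) eps2).
Proof.
have := ginj_composable (G := yon (@gsum C (T2 h))) (idm _ : PO (yon _) (gsum (T2 h))).
by rewrite /= !comp_id_l.
Qed.

Lemma ginj_family_coherent j l k : coherent l (@ginj_family j k).
Proof. by move=> m m' h h' hm b _; rewrite glsE. Qed.

Lemma lret_family_coherent j l : j < l -> coherent l (@lret_family j).
Proof.
move=> jl m m' h h' hm b lm; rewrite /lret_family.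
have yG Y := yon_infty_groupoid (C := C) Y.
rewrite -[LHS]/(bd b hm (lret (H := yon _) h' _ _)).
rewrite (lret_bd (yG _) b hm h (ginj_composable_yon h')).
rewrite -[RHS]/(pm (yev (gls C h h' b hm : PO (yon _) _)) (lret (H := yon _) h _ _)).
by rewrite (pm_lret (yG _) (yG _) _ (ginj_composable_yon h)) /bd /= !glsE.
Qed.

Lemma rret_family_coherent j l : j < l -> coherent l (@rret_family j).
Proof.
move=> jl m m' h h' hm b lm; rewrite /rret_family.
have yG Y := yon_infty_groupoid (C := C) Y.
rewrite -[LHS]/(bd b hm (rret (H := yon _) h' _ _)).
rewrite (rret_bd (yG _) b hm h (ginj_composable_yon h')).
rewrite -[RHS]/(pm (yev (gls C h h' b hm : PO (yon _) _)) (rret (H := yon _) h _ _)).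
by rewrite (pm_rret (yG _) (yG _) _ (ginj_composable_yon h)) /bd /= !glsE.
Qed.

Definition par_class n (a : cell G n) := {x : cell G n | par a x}.

Lemma bij_on_id n (a : cell G n) :
  bij_on (fun x y : par_class a => sim (sval x) (sval y)) (fun x => sval x).
Proof.
split=> // -[x ax] c xc; exists (exist _ c (par_trans ax xc)); exact: sim_refl.
Qed.

Lemma par_class_par n (a : cell G n) (x y : par_class a) : par (sval x) (sval y).
Proof. exact: par_trans (par_sym (svalP x)) (svalP y). Qed.

(** On the pairs [(v, x)], the second projection is the identity of the parallel class of [a], and
    [chain] transfers its bijectivity to [lret]. *)
Lemma lret_bij j n (h : j < n) (v a : cell G n) :
  (forall l (h : l < n), j < l -> left_division h /\ right_division h) ->
  composable h v a ->
  bij_on (fun x y : par_class a => sim (sval x) (sval y)) (fun x => lret h v (sval x)).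
Proof.
move=> divs c.
have cx (x : par_class a) : composable h v (sval x).
  exact: composable_par (par_refl v) (svalP x) c.
pose xi x := proj1_sig (constructive_indefinite_description _ (pair_ex HG (cx x))).
have xi1 x : PM G (ginj (T2 h) eps1) (xi x) = v.
  by rewrite /xi; case: constructive_indefinite_description => ? [].
have xi2 x : PM G (ginj (T2 h) eps2) (xi x) = sval x.
  by rewrite /xi; case: constructive_indefinite_description => ? [].
have ev x : PM G (lret_family h) (xi x) = lret h v (sval x).
  rewrite -[LHS]/(pm (yev (xi x)) (lret (H := yon _) h _ _)).
  rewrite (pm_lret (yon_infty_groupoid _) HG _ (ginj_composable_yon h)) /=.
  by rewrite xi1 xi2.
apply/(bij_on_ext _ ev).
(* The comparison starts at level [j.+1], where the two operations are parallel, so every whiskering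
   is over some [D l] with [l > j], as [divs] demands. *)
apply/(@chain j n h _ _ (exist _ a (par_refl a)) xi _ divs (n - j.+1) j.+1
        (@lret_family j) (ginj_family eps2) (ltnSn j)).
- move=> x y b l hl jl; apply: gls_par; first by rewrite !xi1.
  by rewrite !xi2; apply: par_class_par.
- by rewrite subnKC.
- exact: lret_family_coherent.
- exact: ginj_family_coherent.
- exact: lret_par_top (yon_infty_groupoid _) _ _ _ (ginj_composable_yon _).
- move=> x y; rewrite !ev; apply: cmp_par => //; last exact: composable_invl.
  by apply: cmp_par => //; apply: par_class_par.
- by move=> x y; rewrite !xi2; apply: par_class_par.
by apply/(bij_on_ext _ xi2); apply: bij_on_id.
Qed.

Lemma rret_bij j n (h : j < n) (v a : cell G n) :
  (forall l (h : l < n), j < l -> left_division h /\ right_division h) ->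
  composable h a v ->
  bij_on (fun x y : par_class a => sim (sval x) (sval y)) (fun x => rret h (sval x) v).
Proof.
move=> divs c.
have cx (x : par_class a) : composable h (sval x) v.
  exact: composable_par (svalP x) (par_refl v) c.
pose xi x := proj1_sig (constructive_indefinite_description _ (pair_ex HG (cx x))).
have xi1 x : PM G (ginj (T2 h) eps1) (xi x) = sval x.
  by rewrite /xi; case: constructive_indefinite_description => ? [].
have xi2 x : PM G (ginj (T2 h) eps2) (xi x) = v.
  by rewrite /xi; case: constructive_indefinite_description => ? [].
have ev x : PM G (rret_family h) (xi x) = rret h (sval x) v.
  rewrite -[LHS]/(pm (yev (xi x)) (rret (H := yon _) h _ _)).
  rewrite (pm_rret (yon_infty_groupoid _) HG _ (ginj_composable_yon h)) /=.
  by rewrite xi1 xi2.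
apply/(bij_on_ext _ ev).
apply/(@chain j n h _ _ (exist _ a (par_refl a)) xi _ divs (n - j.+1) j.+1
        (@rret_family j) (ginj_family eps1) (ltnSn j)).
- move=> x y b l hl jl; apply: gls_par; last by rewrite !xi2.
  by rewrite !xi1; apply: par_class_par.
- by rewrite subnKC.
- exact: rret_family_coherent.
- exact: ginj_family_coherent.
- exact: rret_par_top (yon_infty_groupoid _) _ _ _ (ginj_composable_yon _).
- move=> x y; rewrite !ev; apply: cmp_par => //; last exact: composable_invr.
  by apply: cmp_par => //; apply: par_class_par.
- by move=> x y; rewrite !xi1; apply: par_class_par.
by apply/(bij_on_ext _ xi1); apply: bij_on_id.
Qed.

(* Two out of three, applied to [q \o p] and [r \o q]. *)
Lemma division_of_retraction n (a : cell G n) (p q r : cell G n -> cell G n) :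
  (forall x, par a x -> par (p a) (p x)) ->
  (forall x, par (p a) x -> par (q (p a)) (q x)) ->
  (forall x y, par a x -> sim x y -> sim (p x) (p y)) ->
  (forall x y, par (p a) x -> sim x y -> sim (q x) (q y)) ->
  (forall x y, par (q (p a)) x -> sim x y -> sim (r x) (r y)) ->
  bij_on (fun x y : par_class a => sim (sval x) (sval y)) (fun x => q (p (sval x))) ->
  bij_on (fun x y : par_class (p a) => sim (sval x) (sval y)) (fun x => r (q (sval x))) ->
  division a p.
Proof.
move=> pp qp ps qs rs [inj surj] [inj' _]; split=> // [x y ax ay e|c e].
  by apply: (inj (exist _ x ax) (exist _ y ay)); apply: qs => //; apply: pp.
have [[x ax] /= ex] := surj (exist _ a (par_refl a)) (q c) (qp _ e).
exists x => //.
apply: (inj' (exist _ _ (pp _ ax)) (exist _ c e)) => /=.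
by apply: rs => //; apply/qp/pp.
Qed.

Theorem division_cmp j n (h : j < n) : left_division h /\ right_division h.
Proof.
have [d] : exists d, n - j <= d by exists (n - j).
elim: d j h => [|d IH] j h; first by rewrite leqn0 subn_eq0 leqNgt h.
move=> hd.
(* The induction is on the codimension [n - j], which drops when [j] is replaced by a larger [l]. *)
have divs l (hl : l < n) : j < l -> left_division hl /\ right_division hl.
  move=> jl; apply: IH; rewrite -ltnS; apply: leq_trans hd.
  by apply: ltn_sub2l.
have sr := sim_refl P (G := G).
split=> v a c.
  (* The maps [p], [q], [r] compose with [v], its reversal, and the reversal of that; both [q \o p]
     and [r \o q] are then instances of [lret]. *)
  have c1 := composable_invl HG c; have c2 := composable_invl HG c1.
  apply: (@division_of_retraction _ a _ (cmp P h (inv P h v)) (cmp P h (inv P h (inv P h v)))).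
  - by move=> x e; apply: cmp_par.
  - by move=> x e; apply: cmp_par.
  - by move=> x y e s; apply: sim_cmp => //; apply: composable_par c.
  - by move=> x y e s; apply: sim_cmp => //; apply: composable_par c1.
  - by move=> x y e s; apply: sim_cmp => //; apply: composable_par c2.
  - exact: lret_bij.
  - exact: lret_bij.
have c1 := composable_invr HG c; have c2 := composable_invr HG c1.
apply: (@division_of_retraction _ a _ (fun x => cmp P h x (inv P h v))
          (fun x => cmp P h x (inv P h (inv P h v)))).
- by move=> x e; apply: cmp_par.
- by move=> x e; apply: cmp_par.
- by move=> x y e s; apply: sim_cmp => //; apply: composable_par c.
- by move=> x y e s; apply: sim_cmp => //; apply: composable_par c1.
- by move=> x y e s; apply: sim_cmp => //; apply: composable_par c2.
- exact: rret_bij.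
exact: rret_bij.
Qed.

End Chain.
End Division.

(** The one-entry table, whose globular sum is a copy of [D l]. It replaces [D l] because
    [contractible] speaks of the chosen globular sums; its injection is the universal [l]-cell. *)
Definition T1 (l : nat) : table :=
  @Table 0 (fun _ => l) (fun _ => 0) (fun k => False_ind _ (notF (ltn_ord k)))
    (fun k => False_ind _ (notF (ltn_ord k))).

Lemma T1_cell (C : GlobExt) (G : Presheaf C) (HG : is_infty_groupoid G) l (u : cell G l) :
  exists xi : PO G (@gsum C (T1 l)), PM G (ginj (T1 l) ord0) xi = u.
Proof.
have [_ ex] := HG (T1 l).
by have [[]//|xi exi] := ex (fun=> u); exists xi; apply: exi.
Qed.

Lemma tdimension_T1 l : tdimension (T1 l) <= l.
Proof. by apply/bigmax_leqP. Qed.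

(** * Good cells and their reduction to units on objects *)

Section WeakEquivalences.
Variables (C : GlobExt) (P : pregroupoidal C) (HC : contractible C).

Section Good.
Variables (G H : Presheaf C) (HG : is_infty_groupoid G) (HH : is_infty_groupoid H).
Variable f : PMor G H.

Definition good n (a : cell G n) : Prop :=
  (forall x y, par a x -> par a y -> sim (pm f x) (pm f y) -> sim x y) /\
  (forall c : cell H n, par (pm f a) c -> exists2 x, par a x & sim (pm f x) c).

Lemma good_par n (a b : cell G n) : par a b -> good a -> good b.
Proof.
move=> ab [inj surj]; split=> [x y bx by_|c bc].
  by apply: inj; apply: par_trans ab _.
have [x ax xc] := surj c (par_trans (par_pm f ab) bc).
by exists x => //; apply: par_trans (par_sym ab) ax.
Qed.

(** On classes, [p], [q] and the two maps induced by [f] form a commutative square in which [p] and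
    [q] are bijective, so [f] is bijective at [a] exactly when it is at [p a]. *)
Lemma good_division n (a : cell G n) p q :
  division a p -> division (pm f a) q ->
  (forall x, par a x -> pm f (p x) = q (pm f x)) ->
  good (p a) <-> good a.
Proof.
move=> dp dq e; have ea := e a (par_refl a).
have fpar x : par a x -> par (pm f a) (pm f x) by apply: par_pm.
split=> -[inj surj]; split.
- move=> x y ax ay s; apply: (division_inj dp) => //.
  apply: inj; try exact: (division_par dp).
  by rewrite !e //; apply: (division_sim dq) => //; apply: fpar.
- move=> c ac; have [|z az zc] := surj (q c); first by rewrite ea; apply: (division_par dq).
  have [x ax xz] := division_surj dp az; exists x => //.
  apply: (division_inj dq) => //; first exact: fpar.
  by rewrite -e //; apply: (sim_trans P HH _ zc); apply: sim_pm.
- move=> x y ax ay s.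
  have [x' ax' xx'] := division_surj dp ax; have [y' ay' yy'] := division_surj dp ay.
  apply: (sim_trans P HG (sim_sym P xx')); apply: (sim_trans P HG _ yy').
  apply: (division_sim dp) => //; apply: inj => //.
  apply: (division_inj dq); try exact: fpar.
  rewrite -!e //; apply: (sim_trans P HH (sim_pm f xx')).
  by apply: (sim_trans P HH s); apply/sim_pm/(sim_sym P).
move=> c; rewrite ea => qc.
have [c' ac' cc'] := division_surj dq qc.
have [x ax xc] := surj c' ac'.
exists (p x); first exact: (division_par dp).
by rewrite e //; apply: (sim_trans P HH _ cc'); apply: (division_sim dq) => //; apply: fpar.
Qed.

Lemma good_cmpl j n (h : j < n) (v a : cell G n) :
  composable h v a -> good (cmp P h v a) <-> good a.
Proof.
move=> c; have cH := composable_pm f c.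
apply: (good_division (proj1 (division_cmp P HC HG h) v a c)
          (proj1 (division_cmp P HC HH h) _ _ cH)) => x ax.
by apply: pm_cmp => //; apply: composable_par c.
Qed.

Lemma good_cmpr j n (h : j < n) (v a : cell G n) :
  composable h a v -> good (cmp P h a v) <-> good a.
Proof.
move=> c; have cH := composable_pm f c.
apply: (good_division (proj2 (division_cmp P HC HG h) v a c)
          (proj2 (division_cmp P HC HH h) _ _ cH)) => x ax.
by apply: pm_cmp => //; apply: composable_par c.
Qed.

(** Cells [c] and [w] join the [l]-sources and the [l]-targets of [g] and [g']. Composing [g] with
    units on [w] and [g'] with units on [c] keeps goodness by division and makes the [l]-boundaries
    equal, hence those in dimension [l.+1] parallel; this is repeated up to dimension [m]. *)
Lemma good_transfer (Y : Presheaf C) (HY : is_infty_groupoid Y) (phi : PMor Y G) m d l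
    (g g' : cell Y m) (h : l < m) :
  l.+1 + d = m ->
  (forall n (x y : cell Y n), l <= n -> par x y -> sim x y) ->
  (forall b, par (bd b h g) (bd b h g')) ->
  good (pm phi g) <-> good (pm phi g').
Proof.
elim: d l g g' h => [|d IH] l g g' h.
all: move=> em ctr e.
all: have [c [cs ct]] := ctr _ _ _ (leqnn l) (e true).
all: have [w [ws wt]] := ctr _ _ _ (leqnn l) (e false).
all: have cL : composable h (kup P m w) g by rewrite /composable kup_bd_low.
all: have cR : composable h g' (kup P m c) by rewrite /composable kup_bd_low.
all: rewrite -(good_cmpl (composable_pm phi cL)) -(good_cmpr (composable_pm phi cR)).
all: rewrite -!(pm_cmp P HY HG) //.
all: set g1 := cmp P h _ g; set g2 := cmp P h g' _.
all: have e12 b : bd b h g1 = bd b h g2.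
1,3: have [s1 t1] := cmp_bd_same P HY cL; have [s2 t2] := cmp_bd_same P HY cR.
1,2: by case: b; rewrite ?s1 ?t1 ?s2 ?t2 kup_bd_low.
  have p12 : par g1 g2.
    clear -em e12; move: em; rewrite addn0 => em; subst m.
    by apply: par_top => b; rewrite -!(bd_irr b h).
  by split; apply: good_par; [|apply: par_sym]; apply: par_pm.
have h' : l.+1 < m by rewrite -em addnS ltnS leq_addr.
apply: (IH l.+1 g1 g2 h'); first by rewrite addSnnS.
  by move=> n x y ln; apply: ctr; apply: ltnW.
move=> b; apply: par_top => b'.
by rewrite !(bd_bd b' b (ltnSn l) h' h).
Qed.

(** The [l]-boundaries of the first cell are the source and target of [u], those of the second are
    both the source of [u]; these are parallel, so [good_transfer] applies over the universal
    [l.+1]-cell. *)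
Lemma good_kup_src n l (u : cell G l.+1) : l < n ->
  good (kup P n u) <-> good (kup P n (bd true (ltnSn l) u)).
Proof.
move=> ln; have [xi <-] := T1_cell HG u.
pose Y := yon (@gsum C (T1 l.+1)).
pose eta : cell Y l.+1 := ginj (T1 l.+1) ord0.
have -> : kup P n (PM G (ginj (T1 l.+1) ord0) xi : cell G l.+1) = pm (yev xi) (kup P n eta).
  by rewrite pm_kup.
have -> : kup P n (bd true (ltnSn l) (PM G (ginj (T1 l.+1) ord0) xi : cell G l.+1))
        = pm (yev xi) (kup P n (bd true (ltnSn l) eta)).
  by rewrite pm_kup pm_bd.
apply: (@good_transfer Y (yon_infty_groupoid _) _ n (n - l.+1) l _ _ ln).
- by rewrite subnKC.
- move=> m x y lm; apply: (contractible_sim HC).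
  (* Parallel [m]-cells of a sum of dimension [l.+1] are admissible once [l.+1 <= m.+1], that is,
     from dimension [l] on. *)
  by apply: leq_trans (tdimension_T1 _) _.
move=> b; rewrite kup_bd_low kup_bd // kup_id => b' k hk.
by rewrite !(bd_bd b' _ hk (ltnSn l) (ltnW hk)).
Qed.

Lemma good_all n : (forall x : cell G 0, good (kup P n x)) -> forall a : cell G n, good a.
Proof.
move=> g0 a; rewrite -(kup_id P a).
suff key l (u : cell G l) : l <= n -> good (kup P n u) by apply: key.
elim: l u => [|l IH] u hl; first exact: g0.
by apply/good_kup_src => //; apply: IH; apply: ltnW.
Qed.

Lemma pin_hom_pm m (u : cell G m) : pin_hom P f u.
Proof.
move=> x y w _ _ _ _ /(comp_rel_pm f) r w' r'; rewrite (comp_rel_fun HH r' r).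
exact: rst_refl.
Qed.

(** The cells parallel to [x] are those from [src x] to [tgt x], so goodness handles exactly the
    pairs joined by some cell of [G]. *)
Lemma good_pin_bij m (x : cell G m.+1) :
  good x <-> pin_bij f (src x) (tgt x) (pm f (src x)) (pm f (tgt x)).
Proof.
have parE K (z y : cell K m.+1) : par z y <-> src y = src z /\ tgt y = tgt z.
  by rewrite -parallelP; split=> -[].
have es : src (pm f x) = pm f (src x) by rewrite [RHS]pm_nat.
have et : tgt (pm f x) = pm f (tgt x) by rewrite [RHS]pm_nat.
split=> -[A B]; split.
- move=> y ys yt; have [|z /parE[zs zt] zy] := B y; first by apply/parE; rewrite es et.
  by exists z; split=> //; split=> //; apply/(simeqP P HH).
- move=> y z ys yt zs zt /(simeqP P HH) s; apply/(simeqP P HG).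
  by apply: A => //; apply/parE.
- move=> y z /parE[ys yt] /parE[zs zt] s; apply/(simeqP P HG).
  by apply: B => //; apply/(simeqP P HH).
move=> c /parE; rewrite es et => -[cs ct].
have [z [zs [zt /(simeqP P HH) s]]] := A c cs ct.
by exists z => //; apply/parE.
Qed.

Lemma kit_pm m (x : cell G 0) : kit P H m (fc f x) = fc f (kit P G m x).
Proof. by rewrite !kit_kup /fc pm_kup. Qed.

Lemma good_kunit m (u : cell G m) : good (kunit P G u) <-> pin_bij f u u (fc f u) (fc f u).
Proof.
have s : src (kunit P G u) = u := kunit_bd P true u.
have t : tgt (kunit P G u) = u := kunit_bd P false u.
by rewrite good_pin_bij s t.
Qed.

(** For the universal [m.+1]-cell both sides are parallel, so contractibility joins them, and
    evaluation gives the relation for [v]. *)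
Lemma sim_invl m (v : cell G m.+1) :
  sim (cmp P (ltnSn m) (inv P (ltnSn m) v) v) (kunit P G (src v)).
Proof.
have [xi <-] := T1_cell HG v.
have HY := yon_infty_groupoid (@gsum C (T1 m.+1)).
pose eta : cell (yon (@gsum C (T1 m.+1))) m.+1 := ginj (T1 m.+1) ord0.
have c : composable (ltnSn m) (inv P (ltnSn m) eta) eta by rewrite /composable inv_bd_same.
have s : sim (cmp P (ltnSn m) (inv P (ltnSn m) eta) eta) (kunit P _ (src eta)).
  apply: (contractible_sim HC); first exact: leq_trans (tdimension_T1 _) _.
  have [es et] := cmp_bd_same P HY c.
  by apply: par_top; case; rewrite kunit_bd ?es ?et ?inv_bd_same.
have := sim_pm (yev xi) s.
by rewrite (pm_cmp P HY HG _ c) pm_inv [pm _ (kunit _ _ _)]pm_nat [pm _ (src _)]pm_nat.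
Qed.

Lemma sim_invr m (v : cell G m.+1) :
  sim (cmp P (ltnSn m) v (inv P (ltnSn m) v)) (kunit P G (tgt v)).
Proof.
have [xi <-] := T1_cell HG v.
have HY := yon_infty_groupoid (@gsum C (T1 m.+1)).
pose eta : cell (yon (@gsum C (T1 m.+1))) m.+1 := ginj (T1 m.+1) ord0.
have c : composable (ltnSn m) eta (inv P (ltnSn m) eta) by rewrite /composable inv_bd_same.
have s : sim (cmp P (ltnSn m) eta (inv P (ltnSn m) eta)) (kunit P _ (tgt eta)).
  apply: (contractible_sim HC); first exact: leq_trans (tdimension_T1 _) _.
  have [es et] := cmp_bd_same P HY c.
  by apply: par_top; case; rewrite kunit_bd ?es ?et ?inv_bd_same.
have := sim_pm (yev xi) s.
by rewrite (pm_cmp P HY HG _ c) pm_inv [pm _ (kunit _ _ _)]pm_nat [pm _ (tgt _)]pm_nat.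
Qed.

End Good.

(** * Comparison of the four conditions *)

Variables (G H : Presheaf C) (HG : is_infty_groupoid G) (HH : is_infty_groupoid H).
Variable f : PMor G H.

Lemma weak_equivalence_good : weak_equivalence P f ->
  forall m (a : cell G m.+1), good f a.
Proof.
move=> [_ we] m; apply: good_all => // x; rewrite -kit_kup.
by apply/good_kunit => //; rewrite -kit_pm; case: (we m x).
Qed.

Lemma weak_equivalence_pin_bij : weak_equivalence P f ->
  forall m (u v : cell G m), par u v -> pin_bij f u v (fc f u) (fc f v).
Proof.
move=> we m u v uv; have gd := weak_equivalence_good we; split.
  move=> y ys yt.
  (* Goodness requires a cell from [u] to [v] in [G]. The given [y] joins the images, and
     injectivity one dimension lower, on [pi_0] if [m = 0] and from goodness of [u] otherwise,
     yields such a cell. *)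
  have [x0 [xs xt]] : sim u v.
    have s : sim (pm f u) (pm f v) by exists y.
    case: m u v uv y ys yt s => [|m] u v uv y _ _ s.
      have [[_ inj] _] := we.
      by apply/(simeqP P HG)/inj/(simeqP P HH).
    by apply: (proj1 (gd m u)).
  by subst u v; apply: (proj1 (proj1 (good_pin_bij HG HH f x0) (gd _ _))).
move=> x x' xs xt xs' xt' s.
by subst u v; apply: (proj2 (proj1 (good_pin_bij HG HH f x) (gd _ _))).
Qed.

Lemma cond2_weak_equivalence : cond2 P f -> weak_equivalence P f.
Proof. by move=> [p0 iso]; split=> // m x; rewrite kit_pm; apply: iso. Qed.

Lemma weak_equivalence_cond2 : weak_equivalence P f -> cond2 P f.
Proof.
move=> we; split=> [|m u]; first by case: we.
by split; [apply: weak_equivalence_pin_bij|apply: pin_hom_pm].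
Qed.

Lemma weak_equivalence_cond3 : weak_equivalence P f -> cond3 P f.
Proof.
move=> we; have bij := weak_equivalence_pin_bij we; split.
  split; first by move=> x x'; apply: (proj1 (bij 0 x x' _)).
  split; first by move=> x x'; apply: (proj2 (bij 0 x x' _)).
  move=> y; have [[surj _] _] := we.
  have [x /(simeqP P HH)[a [as_ at_]]] := surj y.
  have c1 : composable (ltnSn 0) (inv P (ltnSn 0) a) a by rewrite /composable inv_bd_same.
  have c2 : composable (ltnSn 0) a (inv P (ltnSn 0) a) by rewrite /composable inv_bd_same.
  (* Surjectivity on [pi_0] provides [x] and the arrow [a] from its image to [y]; the reversal of
     [a] is its inverse modulo [sim]. *)
  exists x, a, (inv P (ltnSn 0) a); rewrite -as_ -at_.
  split=> //; split=> //; split; first exact: inv_bd_same.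
  split; first exact: inv_bd_same.
  split; first exists (cmp P (ltnSn 0) (inv P (ltnSn 0) a) a).
    by split; [apply: cmp_rel|apply/(simeqP P HH)/sim_invl].
  exists (cmp P (ltnSn 0) a (inv P (ltnSn 0) a)).
  by split; [apply: cmp_rel|apply/(simeqP P HH)/sim_invr].
by move=> m u v _ /parallelP; apply: bij.
Qed.

Lemma cond3_cond4 : cond3 P f -> cond4 P f.
Proof.
by move=> [[full [_ es]] bij]; split=> //; split=> // m u v m0 uv; case: (bij m u v m0 uv).
Qed.

(* Surjectivity in dimension [m.+1] lifts the cells witnessing [~] in dimension [m]. *)
Lemma cond4_weak_equivalence : cond4 P f -> weak_equivalence P f.
Proof.
move=> [full [es surj]].
have surj' m (u v : cell G m) : par u v -> pin_surj f u v (fc f u) (fc f v).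
  move=> uv; case: m u v uv => [|m] u v uv; first exact: full.
  by apply: surj => //; apply/parallelP.
have inj m (u v : cell G m) : par u v -> simeq H m (fc f u) (fc f v) -> simeq G m u v.
  move=> uv /(simeqP P HH)[y [ys yt]]; have [x [xs [xt _]]] := surj' m u v uv y ys yt.
  by apply/(simeqP P HG); exists x.
split.
  split; last by move=> x x'; apply: inj.
  move=> y; have [x [a [b [as_ [at_ _]]]]] := es y.
  by exists x; apply/(simeqP P HH); exists a.
move=> m x; rewrite kit_pm; split; last exact: pin_hom_pm.
split; first exact: surj'.
move=> y z ys yt zs zt; apply: inj; apply/parallelP.
by split; rewrite ?ys ?yt ?zs ?zt.
Qed.

End WeakEquivalences.

Theorem theorem4 (C : GlobExt) (P : pregroupoidal C) (HC : contractible C)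
  (G H : Presheaf C) (HG : is_infty_groupoid G) (HH : is_infty_groupoid H)
  (f : PMor G H) :
  (weak_equivalence P f <-> cond2 P f) /\
  (weak_equivalence P f <-> cond3 P f) /\
  (weak_equivalence P f <-> cond4 P f).
Proof.
have w3 := weak_equivalence_cond3 (P := P) HC HG HH (f := f).
have w4 := cond4_weak_equivalence (P := P) HG HH (f := f).
split; first split; first exact: weak_equivalence_cond2.
  exact: cond2_weak_equivalence.
split; split=> //; first by move/cond3_cond4.
by move/w3/cond3_cond4.
Qed.
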